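(* There is a countable Hausdorff 0-dimensional topological space that is wH-separable but not H-separable.
   Context: A space is 0-dimensional if it has a base consisting of clopen sets. A space $X$ is H-separable if for every sequence $\{D_n : n\in\omega\}$ of dense subsets of $X$ there is a selection of finite sets $F_n\subset D_n$ ($n\in\omega$) such that for every infinite $A\subset\omega$ the set $\bigcup\{F_n : n\in A\}$ is dense in $X$. A space $X$ is wH-separable (also called mH-separable) if the same conclusion holds for every descending sequence of dense subsets: for every sequence $\{D_n : n\in\omega\}$ of dense subsets of $X$ with $D_{n+1}\subset D_n$ for all $n$, there are finite sets $F_n\subset D_n$ ($n\in\omega$) such that for every infinite $A\subset\omega$ the set $\bigcup\{F_n : n\in A\}$ is dense in $X$. *)

(* Defs.v *)
From mathcomp Require Import all_boot all_order.
From mathcomp Require Import boolp classical_sets functions cardinality.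
From mathcomp Require Import topology.

Set Implicit Arguments.
Unset Strict Implicit.
Unset Printing Implicit Defensive.

Local Open Scope classical_set_scope.

(* The predicate [zero_dimensional] of separation_axioms.v only says that distinct
   points are separated by clopen sets, which is weaker than the existence of a
   base of clopen sets. *)
Definition has_clopen_basis (X : topologicalType) : Prop :=
  exists2 B : set (set X), basis B & B `<=` clopen.

Definition H_selectable (X : topologicalType) (D : nat -> set X) : Prop :=
  exists F : nat -> set X,
    (forall n, finite_set (F n) /\ F n `<=` D n) /\
    (forall A : set nat, infinite_set A -> dense (\bigcup_(n in A) F n)).

Definition H_separable (X : topologicalType) : Prop :=
  forall D : nat -> set X, (forall n, dense (D n)) -> H_selectable D.

Definition wH_separable (X : topologicalType) : Prop :=
  forall D : nat -> set X, (forall n, dense (D n)) ->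
    (forall n, D n.+1 `<=` D n) -> H_selectable D.

(* Main.v *)
From HB Require Import structures.
Require Import Defs.
From mathcomp Require Import all_boot all_order.
From mathcomp Require Import boolp classical_sets functions cardinality.
From mathcomp Require Import topology.

Set Implicit Arguments.
Unset Strict Implicit.
Unset Printing Implicit Defensive.

Local Open Scope classical_set_scope.

(** Let [run a k] be the length of the block of 1s of the binary sequence [a]
    starting at position [k], or 0 if that block is infinite. A triple [(s, c, j)]
    consists of a finite binary word [s], a code [c] of a locally constant
    function [eval c] from the Cantor space to the naturals, and a bound [j]. It
    is tame at [a] if [run a |s| <= j] or [s] is not a prefix of [a]. The triple
    stands for the function which equals [eval c] at its tame points and takes a
    value at infinity elsewhere; the space consists of these countably many
    functions with the topology of pointwise convergence. A triple hits [(A, c)] if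
    it is tame and agrees with [eval c] on the finite set [A]. Hitting [(A, c)] is
    an open condition, and every nonempty open set contains all the triples that
    hit some [(A, c)] ([open_hit]).

    The space is not H-separable: the triples with first component [s] form a
    dense set [D_s], but if [F_s] is a finite subset of [D_s] for each [s], then
    some [a] has [run a k] above every third component occurring in [F_s] with
    [|s| = k], for infinitely many [k] ([run_unbounded]). Hence no element of
    [F_s] is tame at [a] when [s] is one of these infinitely many prefixes of [a],
    and the union of those [F_s] misses an open set. Distinct points share only
    finitely many prefixes, so one [a] constrains [D_s] along a single branch;
    this almost disjointness is what saves the weak property.

    Let now [E_n] be a descending sequence of dense sets. Call [(P, c0)]
    selectable if there are finite [F_n] in [E_n] such that for all [A] and all
    [c] equal to [c0] on [P], almost all [F_n] contain a hit of [(P ++ A, c)]. Say that a hit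
    is clean on [A] if [s] is not a prefix of a point of [A]; a clean hit is a
    locally constant condition on [A]. If, for all such [A] disjoint from [P], each
    [E_n] contains a hit of [(P ++ A, c)] that is clean on [A], then compactness
    gives selectability ([selectable_clean]). If not, since the [E_n] descend, one
    can add finitely many points to [P] such that from some [n] on every hit has
    [s] a prefix of an added point ([not_cleanly_hit]). When this
    occurs twice in a row, [s] is a common prefix of two distinct points, so its
    length is bounded; then one may require [j >= n] in [F_n], and compactness
    applies again ([selectable_bounded]). Thus every [(P, c0)] extends to a
    selectable one ([selectable_dense]). A countable set of points closed under
    these extensions then yields countably many selectable pairs such that every
    [(A, c)] is compatible with one of them ([selection]). *)

(** * Compactness of the Cantor space *)

(** Bar induction on the binary tree: a property of words that holds on a bar and
    passes from the two successors of a word to that word holds at the root. *)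
Lemma bar_induction (Q : seq bool -> Prop) :
    (forall a : nat -> bool, exists N, Q (mkseq a N)) ->
    (forall u, Q (rcons u false) -> Q (rcons u true) -> Q u) ->
  Q [::].
Proof.
move=> barQ indQ; apply: contrapT => nQ0.
pose step u := rcons u `[< Q (rcons u false) >].
pose a n := last false (iter n.+1 step [::]).
have nQ n : ~ Q (iter n step [::]).
  elim: n => // n IHn /=; rewrite /step.
  by case: asboolP => [Qf Qt|//]; apply: IHn; apply: indQ.
have aE n : mkseq a n = iter n step [::].
  by elim: n => // n IHn; rewrite mkseqS IHn /a /= /step last_rcons.
by have [N] := barQ a; rewrite aE => /nQ.
Qed.

Local Notation cantor := (nat -> bool).

(** The two lists of points have the same length, and their points of equal
    index agree below [N]. *)
Definition same_prefixes (N : nat) (A A' : seq cantor) :=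
  map (fun a => mkseq a N) A = map (fun a => mkseq a N) A'.

Lemma same_prefixes_mem N A A' a' :
  same_prefixes N A A' -> a' \in A' -> exists2 a : cantor, a \in A & mkseq a N = mkseq a' N.
Proof.
move=> nAA' a'A'; have := map_f (fun a : cantor => mkseq a N) a'A'.
by rewrite -nAA' => /mapP[a aA ->]; exists a.
Qed.

Lemma mkseq_agree (T : Type) (a a' : nat -> T) N :
  mkseq a N = mkseq a' N -> forall i, i < N -> a i = a' i.
Proof.
move=> e i iN; have := congr1 (fun s => nth (a 0) s i) e.
by rewrite !nth_mkseq.
Qed.

Lemma mkseqW (T : Type) (a a' : nat -> T) M N :
  M <= N -> mkseq a N = mkseq a' N -> mkseq a M = mkseq a' M.
Proof.
move=> MN e; apply/eq_in_map => i; rewrite mem_iota add0n => /andP[_ iM].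
by apply: (mkseq_agree e); apply: leq_trans MN.
Qed.

(** Compactness of the space of [p]-tuples of points, for the cover of [K] by the
    sets [R x] with [x] in [G]: if each tuple has a basic neighbourhood whose
    trace on [K] is empty or within one [R x], finitely many [R x] cover [K]. *)
Lemma finite_cover {T : eqType} (p : nat) (G : T -> Prop)
    (K : seq cantor -> Prop) (R : T -> seq cantor -> Prop) :
    (forall A, size A = p -> exists N,
       (exists2 x, G x & forall A', same_prefixes N A A' -> K A' -> R x A') \/
       (forall A', same_prefixes N A A' -> ~ K A')) ->
  exists2 F : seq T, (forall x, x \in F -> G x) &
    forall A, size A = p -> K A -> exists2 x, x \in F & R x A.
Proof.
move=> locF.
(* A tuple of [p] binary sequences is read off a single interleaved one. *)
pose tup (b : cantor) := mkseq (fun i => (fun m => b (m * p + i)) : cantor) p.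
have tup_size b : size (tup b) = p by rewrite size_mkseq.
pose Q u := exists2 F : seq T, (forall x, x \in F -> G x) &
  forall b, mkseq b (size u) = u -> K (tup b) -> exists2 x, x \in F & R x (tup b).
have [] : Q [::].
  apply: bar_induction => [b|u [F0 G0 H0] [F1 G1 H1]].
    have [N cN] := locF _ (tup_size b); exists (N * p).
    have nearb b' : mkseq b' (N * p) = mkseq b (N * p) -> same_prefixes N (tup b) (tup b').
      move=> e; rewrite /same_prefixes -!map_comp; apply/eq_in_map => i /=.
      rewrite mem_iota add0n => /andP[_ ip].
      apply/eq_in_map => m; rewrite mem_iota add0n => /andP[_ mN].
      apply/esym/(mkseq_agree e).
      by rewrite (leq_trans (n := m.+1 * p)) ?leq_mul2r ?mN ?orbT// mulSn addnC ltn_add2r.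
    case: cN => [[x Gx Rx]|nK].
      exists [:: x] => [y|b']; first by rewrite inE => /eqP ->.
      rewrite size_mkseq => /nearb nb Kb; exists x; first by rewrite inE.
      exact: Rx.
    exists [::] => // b'; rewrite size_mkseq => /nearb nb /nK; exact.
  exists (F0 ++ F1) => [x|b bu Kb].
    by rewrite mem_cat => /orP[/G0|/G1].
  have : mkseq b (size u).+1 = rcons u (b (size u)) by rewrite mkseqS bu.
  case: (b (size u)) => e.
    have [|x xF Rx] := H1 b _ Kb; first by rewrite size_rcons.
    by exists x => //; rewrite mem_cat xF orbT.
  have [|x xF Rx] := H0 b _ Kb; first by rewrite size_rcons.
  by exists x => //; rewrite mem_cat xF.
move=> F GF HF; exists F => // A sA KA.
pose b q := nth (fun=> false) A (q %% p) (q %/ p).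
have Ab : A = tup b.
  apply: (@eq_from_nth _ (fun=> false)); first by rewrite tup_size.
  move=> i; rewrite sA => ip; rewrite nth_mkseq//; apply/funext => m.
  have p0 : 0 < p by apply: leq_ltn_trans ip.
  by rewrite /b modnMDl modn_small// divnMDl// divn_small// addn0.
by rewrite Ab in KA *; apply: HF.
Qed.

(** * Locally constant functions and the combinatorial space *)

(** A code lists pairs [(u, k)]; [eval c a] is the value [k] attached to the
    first word [u] of [c] that is a prefix of [a], and 0 if there is none. *)
Definition code := seq (seq bool * nat).

Definition prefix_of (u : seq bool) (a : cantor) := mkseq a (size u) == u.

Fixpoint eval (c : code) (a : cantor) : nat :=
  if c is (u, k) :: c' then if prefix_of u a then k else eval c' a else 0.

(** [eval c a] depends only on the first [depth c] terms of [a]. *)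
Fixpoint depth (c : code) : nat :=
  if c is (u, _) :: c' then maxn (size u) (depth c') else 0.

Lemma prefix_of_near u (a a' : cantor) N :
  size u <= N -> mkseq a N = mkseq a' N -> prefix_of u a = prefix_of u a'.
Proof. by move=> uN e; rewrite /prefix_of (mkseqW uN e). Qed.

Lemma eval_near c (a a' : cantor) N :
  depth c <= N -> mkseq a N = mkseq a' N -> eval c a = eval c a'.
Proof.
elim: c => //= -[u k] c IHc; rewrite geq_max => /andP[uN cN] e.
by rewrite (prefix_of_near uN e) IHc.
Qed.

(** Finitely many points are told apart by their sufficiently long prefixes. *)
Lemma separation (A : seq cantor) :
  exists N, forall M, N <= M -> {in A &, injective (fun a => mkseq a M)}.
Proof.
have sep2 (a a' : cantor) : exists N, mkseq a N = mkseq a' N -> a = a'.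
  have [->|aa'] := eqVneq a a'; first by exists 0.
  have [i ai] : exists i, a i <> a' i.
    by apply/existsNP => e; move/eqP: aa'; apply; apply/funext.
  by exists i.+1 => /mkseq_agree/(_ i (ltnSn i)).
have sep1 (a : cantor) (B : seq cantor) :
    exists N, forall M, N <= M -> forall b, b \in B -> mkseq a M = mkseq b M -> a = b.
  elim: B => [|b B [N HN]]; first by exists 0.
  have [N' HN'] := sep2 a b; exists (maxn N N') => M.
  rewrite geq_max => /andP[NM N'M] b'; rewrite inE => /predU1P[->|b'B].
    by move=> /(mkseqW N'M).
  exact: HN.
elim: A => [|a A [N HN]]; first by exists 0.
have [N' HN'] := sep1 a A; exists (maxn N N') => M.
rewrite geq_max => /andP[NM N'M] b b'; rewrite !inE.
move=> /predU1P[->|bA] /predU1P[->|b'A] e //; first exact: (HN' M).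
  by apply/esym; apply: (HN' M).
exact: (HN M).
Qed.

Definition agree (P : seq cantor) (c c' : code) :=
  forall a, a \in P -> eval c a = eval c' a.

(** Two locally constant functions that coincide where [P] and [A] meet have a
    common locally constant interpolant. *)
Lemma glue (P A : seq cantor) (c0 c : code) :
    (forall a, a \in P -> a \in A -> eval c0 a = eval c a) ->
  exists c', agree P c' c0 /\ agree A c' c.
Proof.
move=> cc; have [N /(_ N (leqnn N)) sepN] := separation (P ++ A).
pose ext (B : seq cantor) := map (fun b => (mkseq b N, eval c0 b)) B ++ c.
have extE B a : {subset B <= P} -> a \in P ++ A ->
    eval (ext B) a = if a \in B then eval c0 a else eval c a.
  move=> + aPA; elim: B => //= b B IHB BP; rewrite /prefix_of size_mkseq inE.
  have bP : b \in P ++ A by rewrite mem_cat BP// inE eqxx.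
  case: (eqVneq (mkseq a N)) => [e|ab].
    by rewrite (sepN a b aPA bP e) eqxx.
  case: (eqVneq a b) ab => [->|_ _]; first by rewrite eqxx.
  by rewrite IHB// => x xB; apply: BP; rewrite inE xB orbT.
exists (ext P); split => a aX; rewrite extE// ?mem_cat ?aX ?orbT//.
by case: ifP => // aP; apply: cc.
Qed.

(** The length of the block of 1s of [a] starting at [k], and 0 if that block is
    infinite; the latter makes [run] finite everywhere but not continuous. *)
Definition run (a : cantor) (k : nat) : nat :=
  if pselect (exists i, ~~ a (k + i)) is left e then ex_minn e else 0.

Lemma runE (a : cantor) k n :
  (forall i, i < n -> a (k + i)) -> ~~ a (k + n) -> run a k = n.
Proof.
move=> an nan; rewrite /run; case: pselect => [e|]; last by case; exists n.
case: ex_minnP => m nam /(_ n nan) mn; apply/eqP; rewrite eqn_leq mn /=.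
by rewrite leqNgt; apply/negP => /an; apply/negP.
Qed.

Lemma run_large (u : seq bool) (n : nat) :
  exists2 a, prefix_of u a & n <= run a (size u).
Proof.
pose a i := nth false (u ++ nseq n true) i.
exists a.
  apply/eqP/(@eq_from_nth _ false); rewrite size_mkseq// => i iu.
  by rewrite nth_mkseq// /a nth_cat iu.
rewrite (@runE a (size u) n)// => [i iu|]; rewrite /a nth_cat ltnNge leq_addr/=.
  by rewrite addKn nth_nseq iu.
by rewrite addKn nth_nseq ltnn.
Qed.

(** The sequence is made of blocks of [(g (K i)).+1] 1s followed by a 0, the
    [i]-th block starting at [K i]. *)
Lemma run_unbounded (g : nat -> nat) :
  exists a : cantor, exists2 K : nat -> nat, injective K &
    forall i, g (K i) < run a (K i).
Proof.
pose K i := iter i (fun k => k + (g k).+2) 0.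
have KS i : K i.+1 = K i + (g (K i)).+2 by [].
clearbody K.
have K_lt i : K i < K i.+1 by rewrite KS -addSnnS leq_addr.
have K_homo i j : i < j -> K i < K j by apply: (homo_ltn ltn_trans).
have K_homo' i j : i <= j -> K i <= K j.
  by rewrite leq_eqVlt => /predU1P[->//|/K_homo /ltnW].
exists (fun m => ~~ `[< exists i, m.+1 = K i.+1 >]); exists K => [i j e|i].
  by case: (ltngtP i j) => // /K_homo; rewrite e ltnn.
rewrite (@runE _ (K i) (g (K i)).+1)//.
  move=> m mg; apply/negP => /asboolP[j e].
  have : K i < K j.+1 by rewrite -e ltnS leq_addr.
  have : K j.+1 < K i.+1 by rewrite -e KS -addnS ltn_add2l.
  move=> h1 h2; have [ij|ji] := leqP i j.
    by have := K_homo' i.+1 j.+1 ij; rewrite leqNgt h1.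
  by have := K_homo' j.+1 i ji; rewrite leqNgt h2.
by rewrite negbK; apply/asboolP; exists i; rewrite KS -addnS.
Qed.

(** A triple [(s, c, j)]: a binary word, a code and a bound. *)
Definition triple := (seq bool * code * nat)%type.

(** Tameness of [(s, c, j)] at [a]: if [s] is a prefix of [a], then the block of
    1s that follows it is infinite or has length at most [j]. *)
Definition tame (x : triple) (a : cantor) : bool :=
  prefix_of x.1.1 a ==> (run a (size x.1.1) <= x.2).

(** [hit x A c]: the triple [x] is tame and takes the values of [eval c] at all
    points of [A]. *)
Definition hit (x : triple) (A : seq cantor) (c : code) : bool :=
  all (fun a => (eval x.1.2 a == eval c a) && tame x a) A.

Lemma hitP x A c :
  reflect (forall a, a \in A -> eval x.1.2 a = eval c a /\ tame x a) (hit x A c).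
Proof.
apply: (iffP allP) => H a /H; first by move=> /andP[/eqP].
by move=> [/eqP -> ->].
Qed.

Lemma hit_cat x A B c : hit x (A ++ B) c = hit x A c && hit x B c.
Proof. exact: all_cat. Qed.

Lemma hit_sub x A B c : {subset A <= B} -> hit x B c -> hit x A c.
Proof. by move=> AB /hitP H; apply/hitP => a /AB /H. Qed.

Lemma hit_eq x A c c' :
  agree A c c' -> hit x A c -> hit x A c'.
Proof. by move=> cc' /hitP H; apply/hitP => a aA; rewrite -cc'//; apply: H. Qed.

(** Density, expressed on triples. *)
Definition meets_all (E : triple -> Prop) :=
  forall A c, exists2 x, E x & hit x A c.

Lemma hit_exists (s : seq bool) A c : exists j, hit (s, c, j) A c.
Proof.
pose j := \max_(a <- A) run a (size s); exists j; apply/hitP => a aA; split=> //.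
apply/implyP => _ /=; exact: (leq_bigmax_seq (F := fun a => run a (size s))).
Qed.

(** * Local selections *)

(** [(P, c0)] is selectable if finite sets [F n], each within [E n], can be chosen
    that meet every basic open set given by an extension of [eval c0] restricted
    to [P], for almost all [n]. *)
Definition selectable (E : nat -> triple -> Prop) (P : seq cantor) (c0 : code) :=
  exists F : nat -> seq triple,
    (forall n x, x \in F n -> E n x) /\
    (forall A c, agree P c c0 ->
      exists N, forall n, N <= n -> exists2 x, x \in F n & hit x (P ++ A) c).

(** It suffices to select at stage [n], for each size [p] and code [c], a finite
    set that serves all [A] of size [p] in a class [K n], provided that every [A]
    can be replaced by one which eventually lies in these classes. *)
Lemma selectable_from_levels (E : nat -> triple -> Prop) P c0
    (K : nat -> seq cantor -> Prop) (n0 : nat) :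
    (forall A c, agree P c c0 -> exists A',
       (forall x, hit x (P ++ A') c -> hit x (P ++ A) c) /\
       exists N, forall n, N <= n -> K n A') ->
    (forall n p c, n0 <= n -> agree P c c0 ->
       exists2 F : seq triple, (forall x, x \in F -> E n x) &
         forall A, size A = p -> K n A -> exists2 x, x \in F & hit x (P ++ A) c) ->
  selectable E P c0.
Proof.
move=> KA coverF.
have /choice[F0 HF0] : forall npc : nat * nat * code, exists F0 : seq triple,
    (n0 <= npc.1.1 -> agree P npc.2 c0 ->
     (forall x, x \in F0 -> E npc.1.1 x) /\
     forall A, size A = npc.1.2 -> K npc.1.1 A ->
       exists2 x, x \in F0 & hit x (P ++ A) npc.2).
  move=> [[n p] c] /=.
  have [n0n|] := boolP (n0 <= n); last by exists [::].
  have [cc0|] := pselect (agree P c c0); last by exists [::].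
  by have [F FE HF] := coverF n p c n0n cc0; exists F.
(* At stage [n], only the pairs [(p, c)] of index below [n] are served. *)
pose Fc n m := if unpickle m is Some (p, c) then
  if (n0 <= n) && `[< agree P c c0 >] then F0 (n, p, c) else [::] else [::].
exists (fun n => flatten [seq Fc n m | m <- iota 0 n]); split.
  move=> n x /flattenP[s /mapP[m _ ->]]; rewrite /Fc.
  case: unpickle => [[p c]|//]; case: ifP => // /andP[n0n /asboolP cc0].
  exact: (HF0 (n, p, c) n0n cc0).1.
move=> A c cc0; have [A' [A'A [N KN]]] := KA A c cc0.
exists (maxn N (maxn n0 (pickle (size A', c)).+1)) => n.
rewrite !geq_max => /and3P[Nn n0n cn].
have [_ /(_ A' erefl (KN n Nn)) [x xF hx]] := HF0 (n, size A', c) n0n cc0.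
exists x; last exact: A'A.
apply/flattenP; exists (Fc n (pickle (size A', c))).
  by apply: map_f; rewrite mem_iota.
by rewrite /Fc pickleK n0n/= asboolT.
Qed.

(** The word of [x] is not a prefix of any point of [A]. *)
Definition clean (x : triple) (A : seq cantor) :=
  forall a, a \in A -> ~~ prefix_of x.1.1 a.

(** Above [(P, c0)], the sets [E n] meet every basic open set by a triple that is
    clean on the points outside [P]. *)
Definition cleanly_hit (E : nat -> triple -> Prop) P c0 :=
  forall A c n, agree P c c0 -> (forall a, a \in A -> a \notin P) ->
    exists2 x, E n x & hit x (P ++ A) c /\ clean x A.

(** A clean hit of [P ++ A] persists under small changes of [A], so compactness
    applies to the lists [A] whose points differ from those of [P] below [n]. *)
Lemma selectable_clean E P c0 : cleanly_hit E P c0 -> selectable E P c0.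
Proof.
move=> cleanE.
pose K (n : nat) (A : seq cantor) := forall a b : cantor, a \in A -> b \in P -> mkseq a n <> mkseq b n.
apply: (@selectable_from_levels E P c0 K 0) => [A c cc0|n p c _ cc0].
  exists [seq a <- A | a \notin P]; split.
    move=> x; apply: hit_sub => a; rewrite !mem_cat mem_filter.
    by move=> /orP[->//|->]; rewrite andbT orbN.
  have [N sepN] := separation (P ++ A).
  exists N => n Nn a b; rewrite mem_filter => /andP[aP aA] bP e.
  move: aP; rewrite (sepN n Nn a b _ _ e) ?bP// mem_cat ?aA ?bP ?orbT//.
apply: finite_cover => A _.
have [KA|nKA] := pselect (K n A); last first.
  exists n; right => A' nAA' KA'; apply: nKA => a b aA bP e.
  have [a' a'A' e'] := @same_prefixes_mem n A' A a (esym nAA') aA.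
  by apply: (KA' a' b) => //; rewrite e'.
have AP a : a \in A -> a \notin P by move=> aA; apply/negP => /(KA a a aA).
have [x Ex [hx cx]] := cleanE A c n cc0 AP.
pose N := maxn (size x.1.1) (maxn (depth c) (depth x.1.2)).
exists N; left; exists x => // A' nAA' KA'.
move: hx; rewrite !hit_cat => /andP[-> /hitP hx] /=; apply/hitP => a' a'A'.
have [a aA e] := same_prefixes_mem nAA' a'A'.
rewrite /tame -(prefix_of_near _ e) ?leq_maxl// (negbTE (cx a aA))/=.
split=> //; rewrite -(eval_near _ e); last by rewrite !leq_max leqnn !orbT.
rewrite -(eval_near _ e); last by rewrite !leq_max leqnn !orbT.
exact: (hx a aA).1.
Qed.

(** If from some stage on all triples hitting [(P, c0)] have words of length at
    most [L], the triples selected at stage [n] can be given a bound at least [n];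
    they are tame on [A] once [run a k <= n] for all [a] in [A] and [k <= L]. *)
Lemma selectable_bounded E P c0 n0 L :
    (forall n, meets_all (E n)) ->
    (forall n x, n0 <= n -> E n x -> hit x P c0 -> size x.1.1 <= L) ->
  selectable E P c0.
Proof.
move=> dE bE.
pose K n (A : seq cantor) := forall a k, a \in A -> k <= L -> run a k <= n.
apply: (@selectable_from_levels E P c0 K n0) => [A c cc0|n p c n0n cc0].
  exists A; split=> //.
  exists (\max_(a <- A) \max_(k < L.+1) run a k) => n Hn a k aA kL.
  have le1 : run a k <= \max_(i < L.+1) run a i.
    exact: (leq_bigmax (F := fun i : 'I_L.+1 => run a i) (Ordinal (kL : k < L.+1))).
  have le2 : \max_(i < L.+1) run a i <= \max_(b <- A) \max_(i < L.+1) run b i.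
    exact: (leq_bigmax_seq (F := fun b => \max_(i < L.+1) run b i)).
  exact: leq_trans le1 (leq_trans le2 Hn).
apply: finite_cover => A _.
(* The points [z u] enforce [n <= x.2] for every triple [x] that hits them. *)
have /choice[z zP] : forall u : seq bool, exists z : cantor,
    prefix_of u z /\ n <= run z (size u).
  by move=> u; have [a ? ?] := run_large u n; exists a.
pose Z := flatten [seq [seq z (tval t) | t <- enum {: k.-tuple bool}] | k <- iota 0 L.+1].
have ZP u : size u <= L -> z u \in Z.
  move=> uL; apply/flattenP; exists [seq z (tval t) | t <- enum {: (size u).-tuple bool}].
    by apply: (map_f (fun k => [seq z (tval t) | t <- enum {: k.-tuple bool}])); rewrite mem_iota.
  by apply/mapP; exists (in_tuple u); rewrite ?mem_enum.
clearbody Z; have [x Ex] := dE n (P ++ A ++ Z) c.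
rewrite !hit_cat => /and3P[hP hA hZ].
have xL : size x.1.1 <= L by apply: (bE n) => //; apply: hit_eq hP.
have nx : n <= x.2.
  have [_] := hitP _ _ _ hZ _ (ZP _ xL); rewrite /tame.
  by case: (zP x.1.1) => -> /= /leq_trans; apply.
exists (maxn (depth c) (depth x.1.2)); left; exists x => // A' nAA' KA'.
rewrite hit_cat hP; apply/hitP => a' a'A'.
have [a aA e] := same_prefixes_mem nAA' a'A'; split; last first.
  by apply/implyP => _; apply: leq_trans nx; apply: KA'.
rewrite -(eval_near _ e); last by rewrite !leq_max leqnn !orbT.
rewrite -(eval_near _ e); last by rewrite !leq_max leqnn.
exact: (hitP _ _ _ hA a aA).1.
Qed.

(** Some [(P ++ A, c)] has no hit clean on [A] at some stage [n0], hence none at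
    later stages, because the sets [E n] descend. *)
Lemma not_cleanly_hit E P c0 :
    (forall n x, E n.+1 x -> E n x) -> ~ cleanly_hit E P c0 ->
  exists A c n0, [/\ agree P c c0, (forall a, a \in A -> a \notin P) &
    forall n x, n0 <= n -> E n x -> hit x (P ++ A) c ->
      exists2 a, a \in A & prefix_of x.1.1 a].
Proof.
move=> decE ncE.
have decE' n m x : n <= m -> E m x -> E n x.
  move=> nm; rewrite -(subnK nm); elim: (m - n) => // d IHd.
  by rewrite addSn => /decE.
apply: contrapT => nex; apply: ncE => A c n cc0 AP.
apply: contrapT => nE; apply: nex; exists A, c, n; split=> // m x nm Ex hx.
apply: contrapT => nA; apply: nE; exists x; first exact: decE' Ex.
by split=> // a aA; apply/negP => ax; apply: nA; exists a.
Qed.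

Lemma selectable_dense E P c0 :
    (forall n, meets_all (E n)) -> (forall n x, E n.+1 x -> E n x) ->
  exists A c, agree P c c0 /\ selectable E (P ++ A) c.
Proof.
move=> dE decE.
have [cP|] := pselect (cleanly_hit E P c0).
  by exists [::], c0; rewrite cats0; split=> //; apply: selectable_clean.
move=> /(not_cleanly_hit decE)[A1 [c1 [n1 [c1P A1P H1]]]].
have [cP|] := pselect (cleanly_hit E (P ++ A1) c1).
  by exists A1, c1; split=> //; apply: selectable_clean.
move=> /(not_cleanly_hit decE)[A2 [c2 [n2 [c2P A2P H2]]]].
exists (A1 ++ A2), c2; split.
  by move=> a aP; rewrite c2P ?mem_cat ?aP// c1P.
(* The word of a hit is a common prefix of two distinct points, in [A1] and [A2]. *)
have [L sepL] := separation (A1 ++ A2).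
apply: (@selectable_bounded E _ c2 (maxn n1 n2) L) => // n x.
rewrite geq_max => /andP[n1n n2n] Ex; rewrite catA => hx.
have [|a aA1 xa] := H1 n x n1n Ex.
  by apply: (@hit_eq x (P ++ A1) c2) => //; move: hx; rewrite hit_cat => /andP[].
have [a' a'A2 xa'] := H2 n x n2n Ex hx.
rewrite leqNgt; apply/negP => /ltnW Lx.
have e : a = a'.
  apply: (sepL _ Lx); rewrite ?mem_cat ?aA1 ?a'A2 ?orbT//.
  by rewrite (eqP xa) (eqP xa').
by have := A2P a' a'A2; rewrite -e mem_cat aA1 orbT.
Qed.

(** * Selection for descending sequences of dense sets *)

(** The combinatorial form of wH-separability. *)
Lemma selection E :
    (forall n, meets_all (E n)) -> (forall n x, E n.+1 x -> E n x) ->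
  exists2 F : nat -> seq triple, (forall n x, x \in F n -> E n x) &
    forall A c, exists N, forall n, N <= n -> exists2 x, x \in F n & hit x A c.
Proof.
move=> dE decE.
have /choice[w wP] : forall Pc : seq cantor * code, exists w : seq cantor * code,
    agree Pc.1 w.2 Pc.2 /\ selectable E (Pc.1 ++ w.1) w.2.
  move=> [P c0].
  by have [A [c [? ?]]] := selectable_dense P c0 dE decE; exists (A, c).
have /choice[S SP] : forall Pc : seq cantor * code, exists S : nat -> seq triple,
    (forall n x, x \in S n -> E n x) /\
    (forall A c, agree (Pc.1 ++ (w Pc).1) c (w Pc).2 -> exists N, forall n, N <= n ->
       exists2 x, x \in S n & hit x ((Pc.1 ++ (w Pc).1) ++ A) c).
  by move=> Pc; have [_ [F ?]] := wP Pc; exists F.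
(* The ranges of [q 0], [q 1], etc. increase, and their union [Q] is a countable
   set of points: if [P] is listed by [q i], then [q i.+1] lists both [P] and the
   points that [w] adds to it. *)
pose q i := iter i (fun (q : nat -> cantor) n =>
  if unpickle n is Some (l, c, k) then
    nth (q 0) (map q l ++ (w (map q l, c : code)).1) k else q 0) (fun _ _ => false).
have qS i (l : seq nat) c a :
    a \in map (q i) l ++ (w (map (q i) l, c)).1 -> exists n, a = q i.+1 n.
  move=> al; exists (pickle (l, c, index a (map (q i) l ++ (w (map (q i) l, c)).1))).
  by rewrite /q iterS pickleK nth_index.
have qM i j n : i <= j -> exists m, q i n = q j m.
  move=> ij; rewrite -(subnK ij); elim: (j - i) => [|d [m IHd]]; first by exists n.
  rewrite IHd addSn; apply: (qS _ [:: m] [::]); by rewrite inE eqxx.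
pose Q a := exists i n, a = q i n.
have QL (B : seq cantor) : (forall a, a \in B -> Q a) -> exists i l, B = map (q i) l.
  elim: B => [|b B IHB] BQ; first by exists 0, [::].
  have [|i [l ->]] := IHB; first by move=> a aB; apply: BQ; rewrite inE aB orbT.
  have [j [n ->]] := BQ b (mem_head _ _).
  have [m ->] := qM j (maxn i j) n (leq_maxr _ _).
  have [l' ->] : exists l', map (q i) l = map (q (maxn i j)) l'.
    elim: l => [|k l [l' IHl]]; first by exists [::].
    by have [m' e] := qM i (maxn i j) k (leq_maxl _ _); exists (m' :: l'); rewrite /= e IHl.
  by exists (maxn i j), (m :: l').
pose Sm n m := if unpickle m is Some (i, l, c) then S (map (q i) l, c) n else [::].
exists (fun n => flatten [seq Sm n m | m <- iota 0 n]).
  move=> n x /flattenP[s /mapP[m _ ->]]; rewrite /Sm.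
  by case: unpickle => [[[i l] c]|//]; apply: (SP _).1.
move=> A c.
have [i [l Bl]] : exists i l, [seq a <- A | `[< Q a >]] = map (q i) l.
  by apply: QL => a; rewrite mem_filter => /andP[/asboolP].
(* The selectable extension of the part of [(A, c)] within [Q] adds only points of
   [Q], so it is compatible with [(A, c)]. *)
pose Pc := (map (q i) l, c); have [wag _] := wP Pc; have [_ SPc] := SP Pc.
have [c' [c'P c'A]] : exists c', agree (Pc.1 ++ (w Pc).1) c' (w Pc).2 /\ agree A c' c.
  apply: glue => a /qS[n an] aA; apply: wag.
  by rewrite /= -Bl mem_filter aA andbT; apply/asboolP; exists i.+1, n.
have [N HN] := SPc A c' c'P.
exists (maxn N (pickle (i, l, c)).+1) => n; rewrite geq_max => /andP[Nn cn].
have [x xS hx] := HN n Nn; exists x.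
  apply/flattenP; exists (Sm n (pickle (i, l, c))).
    by apply: map_f; rewrite mem_iota.
  by rewrite /Sm pickleK.
apply: (@hit_eq x A c') => //; move: hx; rewrite hit_cat => /andP[_ //].
Qed.

(** * The space *)

(** The function of a triple, as a family of booleans: [values x (a, k)] tells
    whether [x] takes the value [k] at [a]. It is false for all [k] when [x] is not
    tame at [a], which stands for the value at infinity. *)
Definition values (x : triple) (i : cantor * nat) : bool :=
  (eval x.1.2 i.1 == i.2) && tame x i.1.

(** Distinct triples may define the same function; the elements of the space are
    the functions. *)
Definition space := {f : cantor * nat -> bool | exists x, values x = f}.

HB.instance Definition _ := gen_eqMixin space.
HB.instance Definition _ := gen_choiceMixin space.

Definition point_of (x : triple) : space := exist _ (values x) (ex_intro _ x erefl).

Lemma sval_space_inj (f g : space) : sval f = sval g -> f = g.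
Proof. by case: f g => [f pf] [g pg] /= fg; apply: eq_exist. Qed.

Lemma point_of_surj (f : space) : exists x, point_of x = f.
Proof. by case: (svalP f) => x xf; exists x; apply: sval_space_inj. Qed.

Definition cylinder (L : seq (cantor * nat)) (f : space) : set space :=
  [set g | forall i, i \in L -> sval g i = sval f i].

(** The topology of pointwise convergence, with discrete booleans. *)
Definition space_open (U : set space) :=
  forall f, U f -> exists L, cylinder L f `<=` U.

Lemma space_openT : space_open setT.
Proof. by move=> f _; exists [::]. Qed.

Lemma space_openI : setI_closed space_open.
Proof.
move=> U V oU oV f [/oU[L LU] /oV[M MV]]; exists (L ++ M) => g gf.
by split; [apply: LU|apply: MV] => i iL; apply: gf; rewrite mem_cat iL ?orbT.
Qed.

Lemma space_open_bigU (I : Type) (U : I -> set space) :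
  (forall i, space_open (U i)) -> space_open (\bigcup_i U i).
Proof. by move=> oU f [i _ /oU[L LU]]; exists L => g /LU gU; exists i. Qed.

HB.instance Definition _ :=
  isOpenTopological.Build space space_openT space_openI space_open_bigU.

Lemma space_openE : (open : set (set space)) = space_open.
Proof. by []. Qed.

Lemma cylinder_open L f : open (cylinder L f).
Proof.
by rewrite space_openE => g gf; exists L => h hg i iL; rewrite hg// gf.
Qed.

Lemma cylinder_clopen L f : clopen (cylinder L f).
Proof.
split; first exact: cylinder_open.
rewrite -openC space_openE => g ngf; exists L => h hg hf; apply: ngf => i iL.
by rewrite -hg// hf.
Qed.

Lemma space_clopen_basis : has_clopen_basis space.
Proof.
exists [set U | exists L f, U = cylinder L f]; last first.
  by move=> _ [L [f ->]]; apply: cylinder_clopen.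
split=> [_ [L [f ->]]|f U]; first exact: cylinder_open.
rewrite nbhsE => -[V [+ Vf] VU]; rewrite space_openE => oV; have [L LV] := oV f Vf.
exists (cylinder L f); first by split=> //; exists L, f.
exact: subset_trans LV VU.
Qed.

Lemma space_hausdorff : hausdorff_space space.
Proof.
move=> f g fg; apply/sval_space_inj/funext => i.
have [||h [hf hg]] := fg (cylinder [:: i] f) (cylinder [:: i] g).
- by apply: open_nbhs_nbhs; split; [exact: cylinder_open|].
- by apply: open_nbhs_nbhs; split; [exact: cylinder_open|].
by rewrite -hf ?inE// hg ?inE.
Qed.

Lemma space_countable : countable [set: space].
Proof.
have -> : [set: space] = point_of @` [set: triple].
  by apply/seteqP; split=> // f _; have [x <-] := point_of_surj f; exists x.
exact: sub_countable (card_image_le _ _) (countableP _).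
Qed.

Lemma dense_meets_all (D : set space) : dense D -> meets_all (D \o point_of).
Proof.
move=> dD A c; have [j hj] := hit_exists [::] A c.
pose L : seq (cantor * nat) := [seq (a, eval c a) | a <- A].
have hL x : cylinder L (point_of ([::], c, j)) (point_of x) -> hit x A c.
  move=> xL; apply/hitP => a aA.
  have /= := xL _ (map_f (fun a => (a, eval c a)) aA).
  by rewrite /values eqxx/= (hitP _ _ _ hj a aA).2 => /andP[/eqP].
have [|f [fL Df]] := dD _ _ (@cylinder_open L (point_of ([::], c, j))).
  by exists (point_of ([::], c, j)).
by have [x xf] := point_of_surj f; exists x; rewrite /= ?xf//; apply: hL; rewrite xf.
Qed.

(** For a triple [x] in [O], the code [c] agrees with that of [x] at the points of
    [A] where [x] is tame; at the points of [A] where it is not, a large finite value [M] serves in place of infinity. *)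
Lemma open_hit (O : set space) : open O -> O !=set0 ->
  exists A c, forall x, hit x A c -> O (point_of x).
Proof.
rewrite space_openE => oO [f Of]; have [x xf] := point_of_surj f; have [L LO] := oO f Of.
pose M := (\max_(i <- L) i.2).+1.
have ML i : i \in L -> i.2 < M.
  by move=> iL; rewrite ltnS; apply: (leq_bigmax_seq (F := snd)).
pose A := map fst L; pose B := [seq a <- A | ~~ tame x a].
have [|c [cB cA]] := @glue B [seq a <- A | tame x a] [:: ([::], M)] x.1.2.
  by move=> a; rewrite !mem_filter => /andP[/negbTE ->].
exists A, c => y /hitP hy; apply: LO => i iL.
have iA : i.1 \in A by apply: map_f.
have [ey ty] := hy _ iA; rewrite -xf /= /values ey ty andbT.
have [tx|ntx] := boolP (tame x i.1).
  by rewrite cA ?andbT// mem_filter tx.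
rewrite andbF cB ?mem_filter ?ntx//=.
by apply/eqP => e; have := ML i iL; rewrite -e ltnn.
Qed.

Lemma space_wH_separable : wH_separable space.
Proof.
move=> D dD decD.
have [F FD HF] := @selection (fun n => D n \o point_of)
  (fun n => dense_meets_all (dD n)) (fun n x => decD n (point_of x)).
exists (fun n => point_of @` [set` F n]); split=> [n|I infI O O0 oO].
  split; first by apply: finite_image; apply: finite_seq.
  by move=> _ [x xF <-]; apply: FD.
have [A [c hO]] := open_hit oO O0; have [N HN] := HF A c.
have [n [nI Nn]] : exists n, I n /\ N <= n.
  apply: contrapT => nex; apply: infI; apply: sub_finite_set (finite_II N).
  by move=> n In /=; rewrite ltnNge; apply/negP => Nn; apply: nex; exists n.
have [x xF hx] := HN n Nn.
by exists (point_of x); split; [exact: hO|exists n => //; exists x].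
Qed.

Lemma space_not_H_separable : ~ H_separable space.
Proof.
(* [D n] consists of the triples whose word is the one of index [n]. *)
pose ind n : seq bool := odflt [::] (unpickle n).
pose D n : set space := [set f | exists c j, f = point_of (ind n, c, j)].
move=> /(_ D)[|F [FD dF]].
  move=> n O O0 oO; have [A [c hO]] := open_hit oO O0.
  have [j hj] := hit_exists (ind n) A c.
  by exists (point_of (ind n, c, j)); split; [exact: hO|exists c, j].
have /choice[J JP] : forall n, exists J : nat, forall f, F n f ->
    exists c j, f = point_of (ind n, c, j) /\ j <= J.
  move=> n; have [/finite_seqP[s Fs] FDn] := FD n.
  have {FDn} : forall f, f \in s -> D n f by move=> f fs; apply: FDn; rewrite Fs.
  rewrite Fs => {Fs}; elim: s => [|f s IHs] sD; first by exists 0.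
  have [|J HJ] := IHs; first by move=> g gs; apply: sD; rewrite inE gs orbT.
  have [c [j ->]] := sD f (mem_head _ _).
  exists (maxn j J) => g /=; rewrite inE => /predU1P[->|/HJ[c' [j' [-> jJ]]]].
    by exists c, j; split=> //; apply: leq_maxl.
  by exists c', j'; split=> //; apply: leq_trans jJ (leq_maxr _ _).
pose g k := \max_(t : k.-tuple bool) J (pickle (tval t)).
have [a [K Kinj Kg]] := run_unbounded g.
pose idx i := pickle (mkseq a (K i)).
have infI : infinite_set (idx @` setT).
  move=> /(finite_preimage (f := idx)) fin; apply: infinite_nat.
  apply: sub_finite_set (fin _); first by move=> i _; exists i.
  move=> i j _ _ /(pcan_inj pickleK) /(congr1 size).
  by rewrite !size_mkseq => /Kinj.
have [j0 h0] := hit_exists [::] [:: a] [::].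
pose f0 := point_of ([::], [::], j0).
have f0a : sval f0 (a, 0).
  by have [_ ta] := hitP _ _ _ h0 a (mem_head _ _); rewrite /= /values/= ta.
have [|f [f0f [_ [i _ <-] Ff]]] := dF _ infI _ _ (@cylinder_open [:: (a, 0)] f0).
  by exists f0.
have [c [j [fE jJ]]] := JP _ _ Ff.
have : sval f (a, 0) by rewrite f0f ?inE.
rewrite fE /= /values /tame /ind pickleK /= => /andP[_ /implyP].
rewrite /prefix_of size_mkseq eqxx => /(_ isT) run_j.
have := Kg i; rewrite ltnNge => /negP; apply.
apply: leq_trans run_j (leq_trans jJ _).
have sz : size (mkseq a (K i)) == K i by rewrite size_mkseq.
exact: (leq_bigmax (F := fun t : (K i).-tuple bool => J (pickle (tval t))) (Tuple sz)).
Qed.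

Theorem theorem1 :
  exists X : topologicalType,
    [/\ countable [set: X], hausdorff_space X, has_clopen_basis X,
        wH_separable X & ~ H_separable X].
Proof.
exists space; split.
- exact: space_countable.
- exact: space_hausdorff.
- exact: space_clopen_basis.
- exact: space_wH_separable.
- exact: space_not_H_separable.
Qed.
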